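(* Let $a\in\mathbb F^*$. For $g\in\mathcal D_a$ write $x^n-a=hg$ with $h\in\mathcal R$, let $g_0$ be the constant coefficient of $g$, put $\widehat h^{l}=\rho_l(\theta^{-n}(h))$, and define $\delta_a(g)=\theta^{-\deg(g)}(-a^{-1}g_0)\,\widehat h^{l}$. Define $\sigma_b:\mathcal D_b\to\mathcal T_b$, $g\mapsto \mathrm{im}\,M^\theta_b(\overline g)$ for $b\in\{a,a^{-1}\}$, and $\tau_a:\mathcal T_a\to\mathcal T_{a^{-1}}$, $\mathcal C\mapsto\mathcal C^\perp$. Then $\delta_a$ is a well-defined map $\mathcal D_a\to\mathcal D_{a^{-1}}$, the maps $\delta_a,\sigma_a,\sigma_{a^{-1}},\tau_a$ are all lattice anti-isomorphisms, and $\sigma_{a^{-1}}\circ\delta_a=\tau_a\circ\sigma_a$. In particular, if $\mathcal C=\mathrm{im}\,M^\theta_a(\overline g)$ for some $g\in\mathcal D_a$, then $\mathcal C^\perp=\mathrm{im}\,M^\theta_{a^{-1}}(\overline{\delta_a(g)})=\mathrm{im}\,M^\theta_{a^{-1}}(\overline{\widehat h^{l}})$.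
   Context: $\mathbb F$ is a finite field, $\theta\in\mathrm{Aut}(\mathbb F)$, and $\mathcal R=\mathbb F[x;\theta]$ is the skew polynomial ring: elements $\sum_i f_ix^i$ with $f_i\in\mathbb F$ on the left, usual addition, multiplication determined by $xb=\theta(b)x$. $\theta$ and its integer powers act on $\mathcal R$ (and on $\mathbb F$) coefficientwise. $g\mid_r f$ means $f=sg$ for some $s\in\mathcal R$. Fix $n\in\mathbb N$. For $b\in\mathbb F^*$, $\mathcal S_b=\mathcal R/\mathcal R(x^n-b)$ (left $\mathcal R$-module), $\overline f$ is the coset of $f$ (in $M^\theta_b(\overline f)$ taken in $\mathcal S_b$), $\mathfrak p_b:\mathbb F^n\to\mathcal S_b$, $(c_0,\dots,c_{n-1})\mapsto\overline{\sum c_ix^i}$, and $\mathfrak v_b=\mathfrak p_b^{-1}$. The $(\theta,b)$-circulant $M^\theta_b(\overline f)$ is the $n\times n$ matrix whose row with index $i$ ($0\le i\le n-1$) is $\mathfrak v_b(\overline{x^if})$; $\mathrm{im}$ denotes row space. A subspace $\mathcal C\subseteq\mathbb F^n$ is $(\theta,b)$-constacyclic if $\mathfrak p_b(\mathcal C)$ is a left $\mathcal R$-submodule of $\mathcal S_b$. $\mathcal D_b$ is the set of monic right divisors of $x^n-b$, ordered by right divisibility; $\mathcal T_b$ is the set of $(\theta,b)$-constacyclic codes in $\mathbb F^n$, ordered by inclusion. $\mathcal C^\perp$ is the dual with respect to the standard bilinear form on $\mathbb F^n$. For nonzero $f=\sum_{i=0}^tf_ix^i$ with $f_t\neq0$,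 $\rho_l(f)=\sum_{i=0}^t\theta^i(f_{t-i})x^i$. A lattice anti-isomorphism is an order-reversing bijection whose inverse is order-reversing. *)

(* Defs.v *)
From HB Require Import structures.
From mathcomp Require Import all_boot all_order all_algebra.
Set Implicit Arguments. Unset Strict Implicit. Unset Printing Implicit Defensive.
Import GRing.Theory.
Local Open Scope ring_scope.

(* Skew polynomial ring R = F[x; theta]: an element sum_i f_i x^i (coefficients
   on the left) is represented by the coefficient list {poly F}; addition is
   the usual one, multiplication is [smul] below (x b = theta(b) x). *)

Section Skew.
Variable F : finFieldType.
Variable theta : {rmorphism F -> F}.

(* theta^{-1} (theta is an automorphism of the finite field F) *)
Definition thinv : F -> F := finv theta.

Definition smul (p q : {poly F}) : {poly F} :=
  \poly_(k < size p + size q) \sum_(i < k.+1) p`_i * iter i theta q`_(k - i).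

Definition rdvd (g f : {poly F}) : Prop := exists s, f = smul s g.

(* right Euclidean division by a monic g: p = q g + r, deg r < deg g *)
Definition sdiv_step (g : {poly F}) (qr : {poly F} * {poly F}) :=
  let: (q, r) := qr in
  if (size r < size g)%N then (q, r) else
  let m := lead_coef r *: 'X^(size r - size g) in (q + m, r - smul m g).

Definition sdivmod (p g : {poly F}) : {poly F} * {poly F} :=
  iter (size p) (sdiv_step g) (0, p).

Variable n : nat.

Definition xnb (b : F) : {poly F} := 'X^n - b%:P.

Definition Dset (b : F) (g : {poly F}) : Prop := g \is monic /\ rdvd g (xnb b).

(* p_b : F^n -> S_b (as a representative polynomial of degree < n) *)
Definition rpoly (c : 'rV[F]_n) : {poly F} := \sum_(i < n) c 0 i *: 'X^i.

(* v_b(overline f): coefficients of the (unique) representative of degree < n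
   of the coset f + R(x^n - b), i.e. the remainder of right division *)
Definition vb (b : F) (f : {poly F}) : 'rV[F]_n :=
  \row_(j < n) ((sdivmod f (xnb b)).2)`_j.

Definition circ (b : F) (f : {poly F}) : 'M[F]_n :=
  \matrix_(i < n, j < n) ((sdivmod (smul 'X^i f) (xnb b)).2)`_j.

Definition im (M : 'M[F]_n) : {set 'rV[F]_n} := [set u *m M | u : 'rV[F]_n].

Definition is_subspace (C : {set 'rV[F]_n}) : Prop :=
  [/\ 0 \in C, (forall u v, u \in C -> v \in C -> u + v \in C)
    & (forall (k : F) u, u \in C -> k *: u \in C)].

(* (theta,b)-constacyclic code: p_b(C) is a left R-submodule of S_b *)
Definition constacyclic (b : F) (C : {set 'rV[F]_n}) : Prop :=
  is_subspace C /\
  forall (r : {poly F}) c, c \in C -> vb b (smul r (rpoly c)) \in C.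

Definition dual (C : {set 'rV[F]_n}) : {set 'rV[F]_n} :=
  [set v : 'rV[F]_n | [forall c in C, \sum_(i < n) v 0 i * c 0 i == 0]].

Definition hcof (a : F) (g : {poly F}) : {poly F} := (sdivmod (xnb a) g).1.

Definition rho_l (f : {poly F}) : {poly F} :=
  \poly_(i < size f) iter i theta f`_((size f).-1 - i).

Definition hhat (a : F) (g : {poly F}) : {poly F} :=
  rho_l (map_poly (iter n thinv) (hcof a g)).

Definition delta (a : F) (g : {poly F}) : {poly F} :=
  iter (size g).-1 thinv (- a^-1 * g`_0) *: hhat a g.

End Skew.

(* f is a lattice anti-isomorphism from (PA, leA) to (PB, leB):
   an order-reversing bijection PA -> PB whose inverse is order-reversing *)
Definition anti_iso {A B : Type} (PA : A -> Prop) (PB : B -> Prop)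
  (leA : A -> A -> Prop) (leB : B -> B -> Prop) (f : A -> B) : Prop :=
  [/\ (forall x, PA x -> PB (f x)),
      (forall x y, PA x -> PA y -> f x = f y -> x = y),
      (forall y, PB y -> exists2 x, PA x & f x = y)
    & (forall x y, PA x -> PA y -> (leA x y <-> leB (f y) (f x)))].

Definition subset_rel {T : finType} (A B : {set T}) : Prop := A \subset B.

(* Main.v *)
Require Import Defs.
From HB Require Import structures.
From mathcomp Require Import all_boot all_order all_algebra.
From mathcomp Require Import zify.
Set Implicit Arguments. Unset Strict Implicit. Unset Printing Implicit Defensive.
Import GRing.Theory.
Local Open Scope ring_scope.

(* For a monic right divisor g of x^n - b, the row space of M_b(g) is
   { c | g right-divides sum c_i x^i }, spanned by the n - deg g shifts x^i g
   that do not wrap around; Euclidean division then gives the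
   anti-isomorphisms sigma_b.  Writing x^n - a = h g, one has
   theta^n(g) h = x^n - theta^(deg g)(a), whose middle coefficients vanish:
   this says that the shifts of g are orthogonal to those of the reversal
   hhat of h.  Reversal turns products around up to a power of theta, so that
   hhat right-divides x^n - a^-1, and comparing dimensions identifies the dual
   of the code of g with the code of delta_a(g).  The statements on tau_a and
   delta_a follow by transport along sigma_a and sigma_(a^-1). *)

(** * Iterates of a ring endomorphism as ring morphisms *)

Section IterMorphism.
Variables (R : nzRingType) (f : {rmorphism R -> R}) (k : nat).

Fact iter_zmod_morphism : zmod_morphism (iter k f).
Proof. by move=> x y; elim: k => //= m ->; rewrite rmorphB. Qed.

Fact iter_monoid_morphism : monoid_morphism (iter k f).
Proof.
split; first by elim: k => //= m ->; rewrite rmorph1.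
by move=> x y; elim: k => //= m ->; rewrite rmorphM.
Qed.

HB.instance Definition _ :=
  GRing.isZmodMorphism.Build R R (iter k f) iter_zmod_morphism.
HB.instance Definition _ :=
  GRing.isMonoidMorphism.Build R R (iter k f) iter_monoid_morphism.
End IterMorphism.

(** * Arithmetic of the skew polynomial ring *)

Section SkewPolynomials.
Variables (F : finFieldType) (theta : {rmorphism F -> F}).
Implicit Types (p q r g h u v : {poly F}) (b c x : F) (i j k m s t : nat).

Notation "p ** q" := (smul theta p q) (at level 40, left associativity).

(** The truncation in [smul] loses nothing: for [k >= size p + size q], either [i] is past the end
    of [p] or [k - i] is past the end of [q]. *)
Lemma coef_smul p q k :
  (p ** q)`_k = \sum_(i < k.+1) p`_i * iter i theta q`_(k - i).
Proof.
rewrite coef_poly; case: ltnP => // le_k; rewrite big1 // => i _.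
have [le_pi|lt_ip] := leqP (size p) i; first by rewrite nth_default ?mul0r.
rewrite [q`__]nth_default ?rmorph0 ?mulr0 //.
by move: (size p) (size q) (nat_of_ord i) le_k lt_ip => *; lia.
Qed.

Lemma smulDl p q r : (p + q) ** r = p ** r + q ** r.
Proof.
apply/polyP=> k; rewrite coefD !coef_smul -big_split /=.
by apply: eq_bigr => i _; rewrite coefD mulrDl.
Qed.

Lemma smulDr p q r : p ** (q + r) = p ** q + p ** r.
Proof.
apply/polyP=> k; rewrite coefD !coef_smul -big_split /=.
by apply: eq_bigr => i _; rewrite coefD rmorphD mulrDr.
Qed.

Lemma smulZl c p q : (c *: p) ** q = c *: (p ** q).
Proof.
apply/polyP=> k; rewrite coefZ !coef_smul mulr_sumr.
by apply: eq_bigr => i _; rewrite coefZ mulrA.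
Qed.

Lemma smul0l p : 0 ** p = 0.
Proof. by rewrite -[0 in LHS](scale0r 0) smulZl scale0r. Qed.

Lemma smulNl p q : (- p) ** q = - (p ** q).
Proof. by rewrite -!scaleN1r smulZl. Qed.

Lemma smulBl p q r : (p - q) ** r = p ** r - q ** r.
Proof. by rewrite smulDl smulNl. Qed.

Lemma smul0r p : p ** 0 = 0.
Proof. by apply: (addIr (p ** 0)); rewrite -smulDr !add0r. Qed.

Lemma smulNr p q : p ** (- q) = - (p ** q).
Proof. by apply: (addIr (p ** q)); rewrite -smulDr !addNr smul0r. Qed.

Lemma smulBr p q r : p ** (q - r) = p ** q - p ** r.
Proof. by rewrite smulDr smulNr. Qed.

Lemma smul_suml I (s : seq I) (P : pred I) (f : I -> {poly F}) q :
  (\sum_(i <- s | P i) f i) ** q = \sum_(i <- s | P i) f i ** q.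
Proof. apply: (big_morph (fun p => p ** q)); last exact: smul0l.
by move=> p r; apply: smulDl. Qed.

Lemma smulCl c p : c%:P ** p = c *: p.
Proof.
apply/polyP=> k; rewrite coefZ coef_smul big_ord_recl big1 ?addr0 => [|i _].
  by rewrite coefC eqxx subn0.
by rewrite coefC mul0r.
Qed.

Lemma smul1l p : 1 ** p = p.
Proof. by rewrite smulCl scale1r. Qed.

Lemma coef_smulXn i p k :
  ('X^i ** p)`_k = if (k < i)%N then 0 else iter i theta p`_(k - i).
Proof.
rewrite coef_smul; case: ltnP => [lt_ki|le_ik].
  by rewrite big1 // => j _; rewrite coefXn ltn_eqF ?mul0r //
             (leq_trans _ lt_ki).
rewrite (bigD1 (Ordinal (le_ik : (i < k.+1)%N))) //= coefXn eqxx mul1r.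
rewrite big1 ?addr0 // => j; rewrite -val_eqE coefXn => /negPf /= ->.
by rewrite mul0r.
Qed.

Lemma smulMXl p q : (p * 'X) ** q = p ** ('X ** q).
Proof.
apply/polyP=> k; rewrite !coef_smul big_ord_recl coefMX mul0r add0r.
rewrite big_ord_recr /= subnn -['X]expr1 coef_smulXn /= rmorph0 mulr0 addr0.
apply: eq_bigr => i _; rewrite coefMX /= coef_smulXn.
by rewrite ltnS leqn0 subn_eq0 leqNgt ltn_ord /= -iterSr -subnDA addn1.
Qed.

Lemma smulXA p q : ('X ** p) ** q = 'X ** (p ** q).
Proof.
apply/polyP=> k; rewrite -['X]expr1 coef_smulXn coef_smul big_ord_recl.
rewrite coef_smulXn mul0r add0r; case: k => [|k]; first by rewrite big_ord0.
rewrite subn1 /= coef_smul rmorph_sum; apply: eq_bigr => i _.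
by rewrite coef_smulXn /= /bump /= add1n subn1 rmorphM.
Qed.

(** Horner induction on [p]: constants pull out on the left, and a trailing [x] is carried across by
    [smulMXl] and [smulXA]. *)
Lemma smulA p q r : (p ** q) ** r = p ** (q ** r).
Proof.
elim/poly_ind: p q r => [|p c IHp] q r; first by rewrite !smul0l.
by rewrite !smulDl !smulMXl !smulCl smulZl IHp smulXA.
Qed.

(** Only the term [i = (size p).-1] survives: a smaller index overshoots [q], a larger one
    overshoots [p]. *)
Lemma lead_coef_smul p q : (p ** q)`_((size p).-1 + (size q).-1) =
  lead_coef p * iter (size p).-1 theta (lead_coef q).
Proof.
set k := (_ + _)%N; have lt_k: ((size p).-1 < k.+1)%N by rewrite ltnS leq_addr.
rewrite coef_smul (bigD1 (Ordinal lt_k)) //= {2}/k addKn big1 ?addr0 // => i.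
rewrite -val_eqE neq_ltn => /orP[] /= lt_i; last first.
  by rewrite nth_default ?mul0r //; case: (size p) lt_i.
rewrite [q`__]nth_default ?rmorph0 ?mulr0 // /k.
by move: (size p) (size q) (nat_of_ord i) lt_i => *; lia.
Qed.

Lemma iter_theta_eq0 k x : (iter k theta x == 0) = (x == 0).
Proof. exact: fmorph_eq0. Qed.

(** Iterates of [theta] are injective and [F] is a field, so the twisted product of the leading
    coefficients is nonzero. *)
Lemma size_smul p q : p != 0 -> q != 0 ->
  size (p ** q) = (size p + size q).-1.
Proof.
move=> nz_p nz_q; have [sp sq] : (0 < size p)%N /\ (0 < size q)%N.
  by rewrite !size_poly_gt0.
apply/eqP; rewrite eqn_leq; apply/andP; split; last first.
  have -> : (size p + size q).-1 = ((size p).-1 + (size q).-1).+1.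
    by move: (size p) (size q) sp sq => *; lia.
  rewrite ltnNge; apply/negP => /leq_sizeP/(_ _ (leqnn _))/eqP.
  by rewrite lead_coef_smul mulf_eq0 iter_theta_eq0 !lead_coef_eq0
             (negPf nz_p) (negPf nz_q).
apply/leq_sizeP => k le_k; rewrite coef_smul big1 // => i _.
have [le_pi|lt_ip] := leqP (size p) i; first by rewrite nth_default ?mul0r.
rewrite [q`__]nth_default ?rmorph0 ?mulr0 //.
by move: (size p) (size q) (nat_of_ord i) lt_ip le_k sp sq => *; lia.
Qed.

Lemma lead_coef_smul_monic p g : g \is monic ->
  lead_coef (p ** g) = lead_coef p.
Proof.
move=> mon_g; have [->|nz_p] := eqVneq p 0; first by rewrite smul0l.
have nz_g := monic_neq0 mon_g.
rewrite lead_coefE size_smul //.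
have -> : (size p + size g).-1.-1 = ((size p).-1 + (size g).-1)%N.
  move: nz_p nz_g; rewrite -!size_poly_gt0.
  by move: (size p) (size g) => *; lia.
by rewrite lead_coef_smul (monicP mon_g) rmorph1 mulr1.
Qed.

Lemma smul_eq0 p q : (p ** q == 0) = (p == 0) || (q == 0).
Proof.
have [->|nz_p] := eqVneq p 0; first by rewrite smul0l eqxx.
have [->|nz_q] := eqVneq q 0; first by rewrite smul0r eqxx.
rewrite -size_poly_eq0 size_smul //; move: nz_p nz_q; rewrite -!size_poly_gt0.
by move: (size p) (size q) => *; lia.
Qed.


Lemma size_smul_monic p g : g \is monic -> p != 0 ->
  (size g <= size (p ** g))%N.
Proof.
move=> mon_g nz_p; rewrite size_smul ?(monic_neq0 mon_g) //.
by move: nz_p; rewrite -size_poly_gt0; move: (size p) (size g) => *; lia.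
Qed.

(** * Right Euclidean division by a monic polynomial *)

Lemma sdivmodP f g : g \is monic ->
  f = (sdivmod theta f g).1 ** g + (sdivmod theta f g).2
  /\ (size (sdivmod theta f g).2 < size g)%N.
Proof.
move=> mon_g; have nz_g := monic_neq0 mon_g.
rewrite /sdivmod; set k := size f.
(* Each effective step cancels the leading term, so after [m] steps the remainder is either short
   enough or at least [m] shorter than [f]; hence [size f] steps suffice. *)
have inv m : let qr := iter m (sdiv_step theta g) (0, f) in
    f = qr.1 ** g + qr.2 /\ ((size qr.2 < size g) || (size qr.2 + m <= k))%N.
  elim: m => [|m] /=; first by rewrite smul0l add0r addn0 leqnn orbT.
  case: (iter m _ _) => q r /= [def_f]; have [le_r _|le_g /= le_k] := ltnP.
    by split => //=; rewrite le_r.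
  set w := _ *: _; rewrite smulDl -addrA [w ** g + _]addrC subrK; split=> //.
  apply/orP; right.
  have nz_r : r != 0.
    by rewrite -size_poly_gt0 (leq_trans _ le_g) ?size_poly_gt0.
  have nz_w : w != 0.
    by rewrite scaler_eq0 lead_coef_eq0 negb_or nz_r monic_neq0 ?monicXn.
  have sw : size w = (size r - size g).+1.
    by rewrite size_scale ?size_polyXn // lead_coef_eq0.
  have s_wg : size (w ** g) = size r.
    by rewrite size_smul // sw addSn /= subnK.
  suff lt_sz : (size (r - w ** g)%R < size r)%N.
    by rewrite addnS (leq_trans _ le_k) // -addSn leq_add2r.
  have s_r : (0 < size r)%N by rewrite size_poly_gt0.
  rewrite -(prednK s_r) ltnS; apply/leq_sizeP => j.
  rewrite leq_eqVlt => /orP[/eqP <-|lt_j]; last first.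
    by rewrite nth_default // (leq_trans (size_polyD _ _)) // size_polyN s_wg
               maxnn -(prednK s_r).
  rewrite coefB -{2}s_wg -!lead_coefE lead_coef_smul_monic //.
  by rewrite lead_coefZ lead_coefXn mulr1 subrr.
have [] := inv k; set qr := iter _ _ _ => def_f /orP[] // le_k; split=> //.
have -> : qr.2 = 0 by apply/eqP; rewrite -size_poly_eq0; lia.
by rewrite size_poly0 size_poly_gt0.
Qed.

(** Two remainders differ by a left multiple of [g] shorter than [g], which forces equal
    quotients. *)
Lemma sdivmod_unique q r g : g \is monic -> (size r < size g)%N ->
  sdivmod theta (q ** g + r) g = (q, r).
Proof.
move=> mon_g lt_r; have [] := sdivmodP (q ** g + r) mon_g.
case: (sdivmod _ _ _) => q' r' /= eq_f lt_r'.
have eq_r : (q' - q) ** g = r - r'.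
  by apply/eqP; rewrite smulBl subr_eq addrAC eq_sym subr_eq [r + _]addrC eq_f.
have eq_q : q' - q = 0.
  apply/eqP/idPn => /(size_smul_monic mon_g); rewrite eq_r leqNgt.
  by rewrite (leq_ltn_trans (size_polyD _ _)) // size_polyN gtn_max lt_r.
move: eq_r; rewrite eq_q smul0l => /esym/eqP; rewrite subr_eq0 => /eqP ->.
by move/eqP: eq_q; rewrite subr_eq0 => /eqP ->.
Qed.

Lemma monic_smul_quotient p g f :
  g \is monic -> f \is monic -> p ** g = f -> p \is monic.
Proof.
by move=> mon_g mon_f eq_f; rewrite monicE
  -(lead_coef_smul_monic _ mon_g) eq_f -monicE.
Qed.

(** The quotient [s] is monic, and the second divisibility bounds its size by 1, so it equals 1. *)
Lemma rdvd_antisym g h : g \is monic -> h \is monic ->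
  rdvd theta g h -> rdvd theta h g -> g = h.
Proof.
move=> mon_g mon_h [s def_h] [t def_g].
have mon_s := monic_smul_quotient mon_g mon_h (esym def_h).
have sz : (size h <= size g)%N.
  by rewrite def_g size_smul_monic // monic_neq0 //
             (monic_smul_quotient mon_h mon_g).
have s1 : (size s <= 1)%N.
  move: sz; rewrite def_h size_smul ?(monic_neq0 mon_g) ?(monic_neq0 mon_s) //.
  have : (0 < size g)%N by rewrite size_poly_gt0 monic_neq0.
  by move: (size g) (size s) => *; lia.
move: mon_s; rewrite (size1_polyC s1) monicE lead_coefC => /eqP eq1.
by rewrite def_h (size1_polyC s1) eq1 smul1l.
Qed.
End SkewPolynomials.

(** * The inverse automorphism and its iterates *)

Section InverseAutomorphism.
Variables (F : finFieldType) (theta : {rmorphism F -> F}).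

Lemma thinvK : cancel (thinv theta) theta.
Proof. exact/f_finv/fmorph_inj. Qed.

Lemma thetaK : cancel theta (thinv theta).
Proof. exact/finv_f/fmorph_inj. Qed.

HB.instance Definition _ := GRing.isZmodMorphism.Build F F (thinv theta)
  (can2_zmod_morphism thetaK thinvK).
HB.instance Definition _ := GRing.isMonoidMorphism.Build F F (thinv theta)
  (can2_monoid_morphism thetaK thinvK).

Lemma iter_thinvK k : cancel (iter k (thinv theta)) (iter k theta).
Proof. by elim: k => // k IHk x; rewrite iterSr /= thinvK IHk. Qed.

Lemma iter_thetaK k : cancel (iter k theta) (iter k (thinv theta)).
Proof. by elim: k => // k IHk x; rewrite iterSr /= thetaK IHk. Qed.

Lemma iter_thinvC i k x :
  iter i theta (iter k (thinv theta) x) = iter k (thinv theta) (iter i theta x).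
Proof.
apply: (can_inj (iter_thetaK k)).
by rewrite iter_thinvK -iterD addnC iterD iter_thinvK.
Qed.
End InverseAutomorphism.

(** * Skew reversal, and the cofactor [h] of a divisor of [x^n - b] *)

Section Reversal.
Variables (F : finFieldType) (theta : {rmorphism F -> F}).
Implicit Types (p q r g h u v : {poly F}) (b c x : F) (i j k m s t : nat).

Notation "p ** q" := (smul theta p q) (at level 40, left associativity).

Lemma poly_sumE m p : (size p <= m)%N -> p = \sum_(i < m) p`_i *: 'X^i.
Proof.
move=> le_p; rewrite -poly_def; apply/polyP=> k; rewrite coef_poly.
by case: ltnP => // le_k; rewrite nth_default // (leq_trans le_p).
Qed.

Lemma smulE m p q : (size p <= m)%N ->
  p ** q = \sum_(i < m) p`_i *: ('X^i ** q).
Proof.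
move=> le_p; rewrite {1}(poly_sumE le_p) smul_suml.
by apply: eq_bigr => i _; rewrite smulZl.
Qed.

(** Both indices range over a full rectangle with padded bounds, so that reversal can reindex each
    of them independently. *)
Lemma coef_smul_pairs s t p q k : (size p <= s.+1)%N -> (size q <= t.+1)%N ->
  (p ** q)`_k =
  \sum_(i < s.+1) \sum_(j < t.+1 | (i + j == k)%N) p`_i * iter i theta q`_j.
Proof.
move=> le_p le_q; rewrite (smulE _ le_p) coef_sum; apply: eq_bigr => i _.
rewrite coefZ coef_smulXn; case: ltnP => [lt_ki|le_ik].
  by rewrite mulr0 big_pred0 // => j; apply/negbTE;
     rewrite neq_ltn ltn_addr ?orbT.
have eq_k j : ((i + j == k) = (j == k - i))%N by lia.
have [lt_k|le_k] := ltnP (k - i) t.+1.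
  by rewrite (big_pred1 (Ordinal lt_k)) // => j; rewrite eq_k.
rewrite [q`_(k - i)]nth_default ?rmorph0 ?mulr0 ?(leq_trans le_q) //.
rewrite big_pred0 // => j.
by rewrite eq_k ltn_eqF // (leq_trans (ltn_ord j)).
Qed.

(** For [size p <= t.+1] this is the sum of the [x^(t - j) p_j], with coefficients to the right of
    the powers. It is [rho_l] with a formal degree [t], so that upper bounds on degrees suffice
    below. *)
Definition skew_rev t p := \poly_(i < t.+1) iter i theta p`_(t - i).

Lemma coef_skew_rev t p i :
  (skew_rev t p)`_i = if (i <= t)%N then iter i theta p`_(t - i) else 0.
Proof. by rewrite coef_poly ltnS. Qed.

(** The term [u_i theta^i(v_j) x^(i+j)] reverses to [x^(t-j) x^(s-i) theta^i(v_j) u_i]. Moving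
    [theta^i(v_j)] left across [x^(s-i)] turns it into [theta^s(v_j)], which separates the two
    reversals. *)
Lemma skew_rev_smul s t u v : (size u <= s.+1)%N -> (size v <= t.+1)%N ->
  skew_rev (s + t) (u ** v) =
  map_poly (iter s theta) (skew_rev t v) ** skew_rev s u.
Proof.
move=> le_u le_v; apply/polyP=> k; rewrite coef_skew_rev.
rewrite [RHS](@coef_smul_pairs t s) ?size_map_poly ?size_poly //.
rewrite (reindex_inj rev_ord_inj) /=.
case: leqP => [le_k|lt_k]; last first.
  rewrite big1 // => i _; rewrite big1 // => j /eqP eq_k.
  by move: (ltn_ord i) (ltn_ord j) => *; lia.
rewrite (coef_smul_pairs _ le_u le_v) (exchange_big_dep xpredT) //= rmorph_sum.
apply: eq_bigr => i _ /=; rewrite rmorph_sum (reindex_inj rev_ord_inj) /=.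
apply: eq_big => [j|j /eqP eq_k].
  by move: (ltn_ord i) (ltn_ord j); lia.
rewrite coef_map !coef_skew_rev !subSS !leq_subr !subKn ?leq_ord //.
rewrite rmorphM /= -!iterD mulrC; congr (iter _ _ _ * iter _ _ _).
all: by move: (ltn_ord i) (ltn_ord j) => *; lia.
Qed.

Lemma map_poly_smul (f : {rmorphism F -> F}) p q :
  (forall i x, iter i theta (f x) = f (iter i theta x)) ->
  map_poly f (p ** q) = map_poly f p ** map_poly f q.
Proof.
move=> fC; apply/polyP=> k; rewrite coef_map /= !coef_smul rmorph_sum.
by apply: eq_bigr => i _; rewrite !coef_map /= fC rmorphM.
Qed.

Lemma rdvd_scale c g f : c != 0 -> rdvd theta g f -> rdvd theta (c *: g) f.
Proof.
move=> nz_c [s ->]; exists (s ** (c^-1)%:P).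
by rewrite smulA smulCl scalerA mulVf // scale1r.
Qed.

Variable n : nat.
Hypothesis n_gt0 : (0 < n)%N.

Lemma monic_xnb b : xnb n b \is monic.
Proof. exact: monicXnsubC. Qed.

Lemma size_xnb b : size (xnb n b) = n.+1.
Proof. exact: size_XnsubC. Qed.

(** [hcof] is computed by Euclidean division; uniqueness makes the remainder zero. *)
Lemma hcofP b g : Dset theta n b g -> xnb n b = hcof theta n b g ** g.
Proof.
case=> mon_g [s def_x]; rewrite /hcof.
have := @sdivmod_unique F theta s 0 g mon_g.
by rewrite size_poly0 size_poly_gt0 monic_neq0 // addr0 -def_x => ->.
Qed.

Lemma monic_hcof b g : Dset theta n b g -> hcof theta n b g \is monic.
Proof.
move=> Dg; have [mon_g _] := Dg.
exact: monic_smul_quotient mon_g (monic_xnb b) (esym (hcofP Dg)).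
Qed.

Lemma size_hcof b g : Dset theta n b g ->
  ((size (hcof theta n b g)).-1 + (size g).-1)%N = n.
Proof.
move=> Dg; have [mon_g _] := Dg.
have [nz_h nz_g] := (monic_neq0 (monic_hcof Dg), monic_neq0 mon_g).
have := size_xnb b; rewrite (hcofP Dg) size_smul //.
by move: nz_h nz_g; rewrite -!size_poly_gt0; lia.
Qed.

(** Comparison of constant coefficients, where [x^n] contributes nothing as [n > 0]. It explains the
    scalar in [delta]. *)
Lemma hcof_coef0 b g : Dset theta n b g -> (hcof theta n b g)`_0 * g`_0 = - b.
Proof.
move=> Dg; have /(congr1 (fun p : {poly F} => p`_0)) := hcofP Dg.
rewrite coef_smul big_ord1 subnn coefB coefXn coefC eqxx /=.
by rewrite eq_sym (gtn_eqF n_gt0) sub0r => <-.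
Qed.
End Reversal.

(** * The polynomial [hhat], its normalisation [delta], and orthogonality of shifts *)

Section DualGenerator.
Variables (F : finFieldType) (theta : {rmorphism F -> F}).
Implicit Types (p q r g h u v : {poly F}) (a b c x : F) (i j k m s t : nat).

Notation "p ** q" := (smul theta p q) (at level 40, left associativity).

Lemma smulXn p m : p ** 'X^m = p * 'X^m.
Proof.
apply/polyP=> k; rewrite coef_smul coefM.
by apply: eq_bigr => i _; rewrite coefXn rmorph_nat.
Qed.

Lemma coef_smulC p c k : (p ** c%:P)`_k = p`_k * iter k theta c.
Proof.
rewrite coef_smul big_ord_recr /= subnn coefC eqxx big1 ?add0r // => i _.
by rewrite coefC subn_eq0 leqNgt ltn_ord rmorph0 mulr0.
Qed.

Variable n : nat.
Hypothesis n_gt0 : (0 < n)%N.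

Notation hcof := (hcof theta n).

(* [theta^n(g) a = x^n g - theta^n(g) h g] is a left multiple of [g] of the
   same degree, hence equal to [theta^(deg g)(a) g]; then cancel [g]. *)
Lemma hcof_rotate a g : a != 0 -> Dset theta n a g ->
  map_poly (iter n theta) g ** hcof a g = xnb n (iter (size g).-1 theta a).
Proof.
move=> nz_a Dg; have [mon_g _] := Dg; have nz_g := monic_neq0 mon_g.
set q := map_poly _ g; set w := q ** a%:P; set t := 'X^n - q ** hcof a g.
have Xn_g : 'X^n ** g = q ** 'X^n.
  apply/polyP=> k; rewrite smulXn coef_smulXn coefMXn.
  by case: ltnP => //; rewrite coef_map.
have tg : t ** g = w.
  rewrite smulBl Xn_g smulA -(hcofP Dg) -smulBr /xnb opprB addrC subrK.
  by [].
have size_w : (size w <= size g)%N.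
  apply/leq_sizeP => k le_k.
  by rewrite coef_smulC coef_map /= nth_default // rmorph0 mul0r.
have w_lead : w`_(size g).-1 = iter (size g).-1 theta a.
  by rewrite coef_smulC coef_map /= -lead_coefE (monicP mon_g) rmorph1 mul1r.
have size_t : (size t <= 1)%N.
  have [->|nz_t] := eqVneq t 0; first by rewrite size_poly0.
  by move: size_w; rewrite -tg size_smul // -subn1 leq_subLR leq_add2r.
have t_const : t = (iter (size g).-1 theta a)%:P.
  rewrite -w_lead -tg {2}(size1_polyC size_t) smulCl coefZ -lead_coefE.
  by rewrite (monicP mon_g) mulr1; apply: size1_polyC.
by rewrite /xnb -t_const /t opprB addrC subrK.
Qed.

Lemma size_hhat_leq a g : (size (hhat theta n a g) <= size (hcof a g))%N.
Proof. by apply: leq_trans (size_poly _ _) _; rewrite size_map_poly. Qed.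

Lemma hhatE a g : Dset theta n a g ->
  hhat theta n a g = skew_rev theta (size (hcof a g)).-1
                       (map_poly (iter n (thinv theta)) (hcof a g)).
Proof.
move=> Dg; rewrite /hhat /rho_l /skew_rev size_map_poly prednK //.
by rewrite size_poly_gt0 monic_neq0 ?(monic_hcof n_gt0 Dg).
Qed.

Lemma coef_hhat a g i : Dset theta n a g -> (hhat theta n a g)`_i =
  if (i <= (size (hcof a g)).-1)%N
  then iter i theta
         (iter n (thinv theta) (hcof a g)`_((size (hcof a g)).-1 - i))
  else 0.
Proof. by move=> Dg; rewrite hhatE // coef_skew_rev coef_map. Qed.

Lemma skew_rev_xnb b :
  skew_rev theta n (xnb n b) = 1 - (iter n theta b) *: 'X^n.
Proof.
apply/polyP=> i; rewrite coef_skew_rev !(coefB, coefZ, coefXn, coef1, coefC).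
have [le_in|lt_ni] := leqP i n; last first.
  by rewrite !gtn_eqF ?(leq_trans _ lt_ni) // mulr0 subr0.
rewrite rmorphB rmorph_nat /=; congr (_%:R - _); first by lia.
have -> : ((n - i == 0) = (i == n))%N by lia.
by case: eqP => [->|_]; rewrite ?mulr1 ?mulr0 ?rmorph0.
Qed.

(** Applying [theta^(-n)] to [h g = x^n - a] and reversing gives [1 - a x^n] as a left multiple of
    [hhat]; the factor [-a^-1] turns this into [x^n - a^-1]. *)
Lemma rdvd_hhat a g : a != 0 -> Dset theta n a g ->
  rdvd theta (hhat theta n a g) (xnb n a^-1).
Proof.
move=> nz_a Dg; have := @skew_rev_smul F theta (size (hcof a g)).-1
  (size g).-1 (map_poly (iter n (thinv theta)) (hcof a g))
  (map_poly (iter n (thinv theta)) g).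
rewrite !size_map_poly !leqSpred  (size_hcof n_gt0 Dg) => /(_ isT isT).
rewrite -(hhatE Dg) -(map_poly_smul _ _ (iter_thinvC theta ^~ n)) -(hcofP Dg).
rewrite rmorphB /= map_polyXn map_polyC /= skew_rev_xnb iter_thinvK.
set s := map_poly _ _ => def_s; exists (- a^-1 *: s).
rewrite smulZl -def_s scalerBr scalerA mulNr mulVf // scaleNr scaleN1r opprK.
by rewrite addrC alg_polyC.
Qed.

Lemma delta_scale_neq0 a g : a != 0 -> Dset theta n a g ->
  iter (size g).-1 (thinv theta) (- a^-1 * g`_0) != 0.
Proof.
move=> nz_a Dg; rewrite fmorph_eq0 mulf_neq0 ?oppr_eq0 ?invr_eq0 //.
apply: contraNneq nz_a => g0.
by rewrite -oppr_eq0 -(hcof_coef0 n_gt0 Dg) g0 mulr0.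
Qed.

(** Here [theta^(deg h)] and [theta^(-n)] combine to [theta^(-deg g)], the twist used in the scalar
    of [delta]. *)
Lemma hhat_lead a g : Dset theta n a g ->
  (hhat theta n a g)`_(size (hcof a g)).-1 =
  iter (size g).-1 (thinv theta) (hcof a g)`_0.
Proof.
move=> Dg; rewrite coef_hhat // leqnn subnn iter_thinvC.
by rewrite -{1}(size_hcof n_gt0 Dg) addnC iterD iter_thetaK.
Qed.

(** The scalar in [delta] is chosen for this: [theta^(-deg g)] is applied to [-a^-1 g_0 h_0 = 1]. *)
Lemma delta_lead a g : a != 0 -> Dset theta n a g ->
  (delta theta n a g)`_(size (hcof a g)).-1 = 1.
Proof.
move=> nz_a Dg; rewrite coefZ hhat_lead // -rmorphM -mulrA [_`_0 * _]mulrC.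
by rewrite (hcof_coef0 n_gt0 Dg) mulrNN mulVf // rmorph1.
Qed.

Lemma size_delta a g : a != 0 -> Dset theta n a g ->
  size (delta theta n a g) = size (hcof a g).
Proof.
move=> nz_a Dg; apply/eqP; rewrite eqn_leq; apply/andP; split.
  by rewrite size_scale ?delta_scale_neq0 // size_hhat_leq.
have := delta_lead nz_a Dg; apply: contra_eqT; rewrite -ltnNge => lt_s.
rewrite nth_default ?(eq_sym 0) ?oner_eq0 // -ltnS prednK //.
exact: leq_trans lt_s.
Qed.

Lemma delta_Dset a g : a != 0 -> Dset theta n a g ->
  Dset theta n a^-1 (delta theta n a g).
Proof.
move=> nz_a Dg; split.
  by rewrite monicE lead_coefE size_delta // delta_lead.
exact/rdvd_scale/rdvd_hhat/Dg/nz_a/delta_scale_neq0.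
Qed.

(* After applying [theta^n], this inner product is [theta^i] of the coefficient
   of [x^(deg h + l - i)] in [theta^n(g) h]. *)
Lemma shift_orthogonal a g i l : a != 0 -> Dset theta n a g ->
  (i < (size (hcof a g)).-1)%N -> (l < (size g).-1)%N ->
  \sum_(m < n) ('X^i ** g)`_m * ('X^l ** hhat theta n a g)`_m = 0.
Proof.
move=> nz_a Dg; set h := hcof a g; set d := (size h).-1 => lt_i lt_l.
have eq_n : (d + (size g).-1)%N = n := size_hcof n_gt0 Dg.
set k := (d + l - i)%N; set q := map_poly (iter n theta) g.
(* [0 < k < n] because [i < deg h] and [l < deg g], so [x^n - theta^(deg g)(a)] has no term in
   degree [k]. *)
have qh_k : (q ** h)`_k = 0.
  have [ne_kn ne_k0] : (k == n) = false /\ (k == 0%N) = false.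
    by split; rewrite /k; lia.
  by rewrite hcof_rotate // coefB coefXn coefC ne_kn ne_k0 subr0.
apply: (fmorph_inj (iter n theta)); rewrite rmorph0 rmorph_sum.
transitivity (iter i theta (q ** h)`_k); last by rewrite qh_k rmorph0.
pose G m :=
  iter n theta (iter i theta g`_(m - i)) * iter m theta h`_(d + l - m).
(* The window of indices [i <= m <= i + k] ends at [d + l], which is below [n] since [l < deg g]. *)
have le_kn : (i + k.+1 <= n)%N by lia.
transitivity (\sum_(0 <= m < n | (i <= m < i + k.+1)%N) G m).
  rewrite big_mkord [RHS]big_mkcond; apply: eq_bigr => m _ /=.
  rewrite !coef_smulXn coef_hhat // -/h -/d rmorphM.
  have [lt_mi|le_im] /= := ltnP m i; first by rewrite rmorph0 mul0r.
  have [lt_ml|le_lm] := ltnP m l.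
    (* For [m < l] the index [d + l - m] exceeds the degree of [h], so [G m] vanishes as well. *)
    rewrite rmorph0 mulr0 /G; case: ifP => // _.
    rewrite [h`_(d + l - m)]nth_default ?rmorph0 ?mulr0 //.
    by apply: leq_trans (leqSpred _) _; rewrite -/d; clearbody d; lia.
  have -> : (m < i + k.+1)%N = (m - l <= d)%N by lia.
  case: ifP => le_d; last by rewrite !rmorph0 mulr0.
  rewrite /G; congr (_ * _).
  (* [theta^n] cancels the [theta^(-n)] inside [hhat], while [theta^l] and [theta^(m - l)] combine
     to [theta^m]. *)
  rewrite -iterD subnKC // iter_thinvC iter_thinvK.
  by congr (iter _ _ _`_ _); lia.
transitivity (\sum_(i <= m < i + k.+1) G m).
  by rewrite [RHS](big_nat_widenl _ 0) // [RHS](big_nat_widen _ _ n) //.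
rewrite -{1}[i]add0n big_addn addKn big_mkord coef_smul rmorph_sum.
apply: eq_bigr => j _; rewrite /G addnK coef_map /= rmorphM /= -!iterD.
by congr (iter _ _ _ * iter _ _ _`_ _); lia.
Qed.
End DualGenerator.

(** * Duals of row spaces *)

Section Duality.
Variables (F : finFieldType) (n : nat).

Lemma im_submx (M : 'M[F]_n) : im M = [set c | (c <= M)%MS].
Proof.
apply/setP=> c; rewrite inE; apply/imsetP/submxP => [[u _ ->]|[u ->]].
  by exists u.
by exists u.
Qed.

Lemma dual_submx m (A : 'M[F]_(m, n)) :
  dual [set c | (c <= A)%MS] = [set v | (v <= kermx A^T)%MS].
Proof.
have dotE (v c : 'rV[F]_n) : \sum_(i < n) v 0 i * c 0 i = (v *m c^T) 0 0.
  by rewrite mxE; apply: eq_bigr => i _; rewrite mxE.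
apply/setP=> v; rewrite !inE; apply/'forall_implyP/sub_kermxP => [v_dual|vA c].
  apply/rowP=> k; rewrite mxE [RHS]mxE.
  have := v_dual (row k A); rewrite inE row_sub => /(_ isT)/eqP dot0.
  by rewrite -[RHS]dot0; apply: eq_bigr => i _; rewrite !mxE.
rewrite inE => /submxP[D ->]; rewrite dotE trmx_mul mulmxA vA mul0mx.
by rewrite mxE.
Qed.

(** The row space of [A] lies in the double kernel, and both have the same rank,
    [r = n - (n - r)]. *)
Lemma dual_dual_submx m (A : 'M[F]_(m, n)) :
  dual (dual [set c | (c <= A)%MS]) = [set c | (c <= A)%MS].
Proof.
rewrite !dual_submx; set B := kermx A^T; set K := kermx B^T.
have sAK : (A <= K)%MS.
  by apply/sub_kermxP; rewrite -[A]trmxK -trmx_mul mulmx_ker trmx0.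
have rkK : \rank K = \rank A.
  by rewrite !(mxrank_ker, mxrank_tr) subKn // rank_leq_col.
have [_] := mxrank_leqif_eq sAK; rewrite rkK eqxx => /esym/eqmxP eqAK.
by apply/setP=> c; rewrite !inE eqAK.
Qed.

Lemma dual_subset (C D : {set 'rV[F]_n}) : C \subset D -> dual D \subset dual C.
Proof.
move/subsetP=> sCD; apply/subsetP=> v; rewrite !inE => /'forall_implyP vD.
by apply/'forall_implyP => c /sCD; apply: vD.
Qed.
End Duality.

(** * Constacyclic codes and their generators *)

Section ConstacyclicCodes.
Variables (F : finFieldType) (theta : {rmorphism F -> F}).
Implicit Types (p q r g h u v f s : {poly F}) (a b : F).

Notation "p ** q" := (smul theta p q) (at level 40, left associativity).

Lemma rpolyE m (c : 'rV[F]_m) : rpoly c = rVpoly c.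
Proof.
rewrite (poly_sumE (size_poly _ _ : size (rVpoly c) <= m)%N).
by apply: eq_bigr => i _; rewrite coef_rVpoly_ord.
Qed.

Lemma size_rVpoly m (c : 'rV[F]_m) : (size (rVpoly c) <= m)%N.
Proof. exact: size_poly. Qed.

Lemma rdvd_smul g f p : rdvd theta g f -> rdvd theta g (p ** f).
Proof. by case=> s ->; exists (p ** s); rewrite smulA. Qed.

Lemma rdvd_sub g f p : rdvd theta g f -> rdvd theta g p -> rdvd theta g (f - p).
Proof. by case=> s -> [t ->]; exists (s - t); rewrite smulBl. Qed.

Lemma rdvd_trans g f p : rdvd theta g f -> rdvd theta f p -> rdvd theta g p.
Proof. by move=> g_f [t ->]; apply: rdvd_smul. Qed.

Lemma smulXnZ i c f : 'X^i ** (c *: f) = iter i theta c *: ('X^i ** f).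
Proof.
apply/polyP=> k; rewrite coefZ !coef_smulXn; case: ifP; rewrite ?mulr0 // => _.
by rewrite coefZ rmorphM.
Qed.

Variable n : nat.
Hypothesis n_gt0 : (0 < n)%N.

Notation vb := (vb theta n).
Notation circ := (circ theta n).
Notation Dset := (Dset theta n).

Lemma vb_unique b f q r : (size r <= n)%N -> f = q ** xnb n b + r ->
  vb b f = poly_rV r.
Proof.
move=> le_r ->; rewrite /vb sdivmod_unique ?monic_xnb // size_xnb //.
Qed.

Lemma vb_divP b f : exists q, f = q ** xnb n b + rVpoly (vb b f).
Proof.
have [def_f lt_r] := sdivmodP theta f (monic_xnb n_gt0 b).
exists (sdivmod theta f (xnb n b)).1.
by rewrite poly_rV_K // -ltnS -(size_xnb n_gt0 b).
Qed.

Lemma vb_linear b : linear (vb b).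
Proof.
move=> c f g; have [[qf def_f] [qg def_g]] := (vb_divP b f, vb_divP b g).
rewrite {1}def_f {1}def_g (@vb_unique b _ (c *: qf + qg)
          (rVpoly (c *: vb b f + vb b g))) ?size_rVpoly ?rVpolyK //.
by rewrite linearP smulDl smulZl scalerDr addrACA.
Qed.

HB.instance Definition _ b :=
  GRing.isLinear.Build F {poly F} 'rV[F]_n *:%R (vb b) (vb_linear b).

Lemma vb_rVpoly b (c : 'rV[F]_n) : vb b (rVpoly c) = c.
Proof.
by rewrite (@vb_unique b _ 0 (rVpoly c)) ?size_rVpoly ?rVpolyK // smul0l add0r.
Qed.


Lemma vb_smul_xnb b q : vb b (q ** xnb n b) = 0.
Proof. by rewrite (@vb_unique b _ q 0) ?size_poly0 ?addr0 ?linear0. Qed.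

Lemma row_circ b f i : row i (circ b f) = vb b ('X^i ** f).
Proof. by apply/rowP=> j; rewrite !mxE. Qed.

(** Reduction subtracts a left multiple of [x^n - b], itself a left multiple of [g]. *)
Lemma rdvd_vb b g f : Dset b g -> rdvd theta g f ->
  rdvd theta g (rVpoly (vb b f)).
Proof.
move=> [_ g_x] g_f; have [q def_f] := vb_divP b f.
have -> : rVpoly (vb b f) = f - q ** xnb n b.
  by rewrite [X in _ = X - _]def_f addrC addKr.
exact/rdvd_sub/rdvd_smul.
Qed.


Lemma size_gt0_Dset b g : Dset b g -> (0 < size g)%N.
Proof. by case=> mon_g _; rewrite size_poly_gt0 monic_neq0. Qed.

(** With [i < n - deg g] the shift [x^i g] has degree below [n], so no reduction modulo [x^n - b]
    enters. For [deg g = n] there are no rows, giving the zero code. *)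
Definition gen_mx g : 'M[F]_(n - (size g).-1, n) :=
  \matrix_(i, j) ('X^i ** g)`_j.

Lemma row_gen_mx g i : row i (gen_mx g) = poly_rV ('X^i ** g).
Proof. by apply/rowP=> j; rewrite !mxE. Qed.

Lemma size_shift b g (i : 'I_(n - (size g).-1)) : Dset b g ->
  (size ('X^i ** g) <= n)%N.
Proof.
move=> Dg; have [mon_g _] := Dg; have lt_i := ltn_ord i.
rewrite size_smul ?monic_neq0 ?monicXn // size_polyXn.
by have := size_gt0_Dset Dg; lia.
Qed.

Lemma rVpoly_gen_mx b g (u : 'rV[F]_(n - (size g).-1)) : Dset b g ->
  rVpoly (u *m gen_mx g) = rVpoly u ** g.
Proof.
move=> Dg; rewrite mulmx_sum_row linear_sum (smulE theta _ (size_rVpoly u)).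
apply: eq_bigr => i _; rewrite linearZ /= coef_rVpoly_ord row_gen_mx.
by rewrite poly_rV_K // (size_shift _ Dg).
Qed.

(** A quotient [s] of a word by [g] has size at most [n - deg g] because degrees add, so it is a
    legitimate row of coefficients. *)
Lemma sub_gen_mxP b g (c : 'rV[F]_n) : Dset b g ->
  (c <= gen_mx g)%MS <-> rdvd theta g (rVpoly c).
Proof.
move=> Dg; have [mon_g _] := Dg; split=> [/submxP[u ->]|[s def_c]].
  by exists (rVpoly u); rewrite (rVpoly_gen_mx _ Dg).
apply/submxP; exists (poly_rV s); apply: (can_inj rVpolyK).
rewrite (rVpoly_gen_mx _ Dg) poly_rV_K //.
have [->|nz_s] := eqVneq s 0; first by rewrite size_poly0.
have := size_rVpoly c; rewrite def_c size_smul ?(monic_neq0 mon_g) //.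
by have := size_gt0_Dset Dg; lia.
Qed.

(** The rows are free because right multiplication by [g] is injective. *)
Lemma rank_gen_mx b g : Dset b g -> \rank (gen_mx g) = (n - (size g).-1)%N.
Proof.
move=> Dg; have [mon_g _] := Dg; apply/eqP/inj_row_free => u uG0.
apply: (can_inj rVpolyK); rewrite linear0; apply/eqP.
have /eqP := rVpoly_gen_mx u Dg.
by rewrite uG0 linear0 eq_sym smul_eq0 (negPf (monic_neq0 mon_g)) orbF.
Qed.

(** Reduction keeps every row of the circulant a left multiple of [g]; conversely its first
    [n - deg g] rows need no reduction and are the rows of [gen_mx g]. *)
Lemma circ_gen_mx b g : Dset b g -> (circ b g :=: gen_mx g)%MS.
Proof.
move=> Dg; apply/eqmxP/andP; split; apply/row_subP => i.
  rewrite row_circ; apply/(sub_gen_mxP _ Dg)/(rdvd_vb Dg)/rdvd_smul.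
  by exists 1; rewrite smul1l.
rewrite row_gen_mx; set w := widen_ord (leq_subr _ _) i.
suff -> : poly_rV ('X^i ** g) = row w (circ b g) by apply: row_sub.
by rewrite row_circ -(vb_rVpoly b (poly_rV _)) poly_rV_K // (size_shift _ Dg).
Qed.

Lemma im_circE b g : Dset b g -> im (circ b g) = [set c | (c <= gen_mx g)%MS].
Proof.
by move=> Dg; rewrite im_submx; apply/setP=> c; rewrite !inE circ_gen_mx.
Qed.

Lemma im_circP b g (c : 'rV[F]_n) : Dset b g ->
  c \in im (circ b g) <-> rdvd theta g (rVpoly c).
Proof. by move=> Dg; rewrite im_circE // inE; apply: (sub_gen_mxP c Dg). Qed.

(** Scaling [f] by [k] scales row [i] of the circulant by [theta^i(k)]. *)
Lemma im_circ_scale_sub b k f : im (circ b (k *: f)) \subset im (circ b f).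
Proof.
rewrite !im_submx; apply/subsetP=> c; rewrite !inE => /submx_trans; apply.
apply/row_subP => i.
by rewrite row_circ smulXnZ linearZ /= -row_circ scalemx_sub ?row_sub.
Qed.

Lemma im_circ_scale b k f : k != 0 -> im (circ b (k *: f)) = im (circ b f).
Proof.
move=> nz_k; apply/eqP; rewrite eqEsubset im_circ_scale_sub /=.
by rewrite -{1}[f](scalerK nz_k) im_circ_scale_sub.
Qed.

(** Orthogonality of the shifts gives one inclusion; both sides have dimension [deg g], so they
    coincide. *)
Lemma im_delta a g : a != 0 -> Dset a g ->
  im (circ a^-1 (delta theta n a g)) = dual (im (circ a g)).
Proof.
move=> nz_a Dg; have Dd := delta_Dset n_gt0 nz_a Dg.
rewrite !im_circE // dual_submx; set G := gen_mx g; set H := gen_mx _.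
have deg_sum := size_hcof n_gt0 Dg.
have sHG : (H <= kermx G^T)%MS.
  apply/sub_kermxP/matrixP => l i; rewrite !mxE.
  have lt_i : (i < (size (hcof theta n a g)).-1)%N.
    by have := ltn_ord i; lia.
  have lt_l : (l < (size g).-1)%N.
    have := ltn_ord l.
    rewrite [X in (_ < n - X.-1)%N](size_delta n_gt0 nz_a Dg).
    by move: (nat_of_ord l) => *; lia.
  set e := iter (size g).-1 (thinv theta) (- a^-1 * g`_0).
  (* The normalising scalar [e] leaves [x^l] as [theta^l(e)], which reduces the claim to the shifts
     of [hhat]. *)
  transitivity (iter l theta e * \sum_(m < n)
      ('X^i ** g)`_m * ('X^l ** hhat theta n a g)`_m); last first.
    by rewrite (shift_orthogonal n_gt0 nz_a Dg lt_i lt_l) mulr0.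
  rewrite mulr_sumr; apply: eq_bigr => m _.
  by rewrite !mxE smulXnZ coefZ -mulrA [_`_m * _`_m]mulrC.
have rk : \rank H = \rank (kermx G^T).
  rewrite mxrank_ker mxrank_tr (rank_gen_mx Dd) (rank_gen_mx Dg) size_delta //.
  by lia.
have [_] := mxrank_leqif_eq sHG; rewrite rk eqxx => /esym/eqmxP eqHG.
by apply/setP=> c; rewrite !inE eqHG.
Qed.

Lemma im_circ_constacyclic b g : Dset b g ->
  constacyclic theta b (im (circ b g)).
Proof.
move=> Dg; split=> [|r c].
  rewrite im_submx; split=> [|u v|k u]; rewrite !inE ?sub0mx //.
    exact: addmx_sub.
  exact: scalemx_sub.
rewrite rpolyE => /(im_circP _ Dg) g_c.
exact/(im_circP _ Dg)/(rdvd_vb Dg)/rdvd_smul.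
Qed.

Lemma im_circ_subset b g h : Dset b g -> Dset b h ->
  rdvd theta g h <-> im (circ b h) \subset im (circ b g).
Proof.
move=> Dg Dh; split=> [g_h|/subsetP sub_im].
  apply/subsetP=> c /(im_circP _ Dh) h_c; apply/(im_circP _ Dg).
  exact: rdvd_trans h_c.
(* A divisor of degree below [n] is itself a word of its code and can be tested; in degree [n] it
   can only be [x^n - b], which [g] divides. *)
have [le_h|gt_h] := leqP (size h) n.
  have /sub_im/(im_circP _ Dg) : poly_rV h \in im (circ b h).
    by apply/(im_circP _ Dh); exists 1; rewrite smul1l poly_rV_K.
  by rewrite poly_rV_K.
have [mon_h _] := Dh; suff -> : h = xnb n b by case: Dg.
apply: (@rdvd_antisym _ theta); rewrite ?monic_xnb //; first by case: Dh.
exists 1; rewrite smul1l [RHS](hcofP Dh).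
have := size_hcof n_gt0 Dh; have := monic_hcof n_gt0 Dh.
move=> mon_k deg_sum; have size1 : (size (hcof theta n b h) <= 1)%N by lia.
move: mon_k; rewrite (size1_polyC size1) monicE lead_coefC => /eqP ->.
by rewrite smul1l.
Qed.

Lemma im_circ_inj b g h : Dset b g -> Dset b h ->
  im (circ b g) = im (circ b h) -> g = h.
Proof.
move=> Dg Dh eq_im; have [[mon_g _] [mon_h _]] := (Dg, Dh).
by apply: (@rdvd_antisym _ theta) => //;
   apply/(im_circ_subset (b := b)); rewrite ?eq_im.
Qed.

(* A monic word of least degree generates the code; the zero code is generated
   by [x^n - b]. *)
Lemma constacyclic_generator b (C : {set 'rV[F]_n}) : constacyclic theta b C ->
  exists2 g, Dset b g & im (circ b g) = C.
Proof.
move=> [[C0 C_add C_scale] C_mul].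
  have C_sub (u v : 'rV[F]_n) : u \in C -> v \in C -> u - v \in C.
  by move=> Cu Cv; rewrite -scaleN1r C_add ?C_scale.
have [/exists_inP[c0 Cc0 nz_c0]|] := boolP [exists c in C, c != 0]; last first.
  rewrite negb_exists_in => /forall_inP C_0.
  have Dx : Dset b (xnb n b).
    by split; [apply: monic_xnb | exists 1; rewrite smul1l].
  exists (xnb n b) => //; apply/setP=> c; apply/idP/idP => [|Cc].
    case/(im_circP _ Dx) => s def_c; suff -> : c = 0 by [].
    by rewrite -(vb_rVpoly b c) def_c vb_smul_xnb.
  have := C_0 c Cc; rewrite negbK => /eqP ->.
  by apply/(im_circP _ Dx); exists 0; rewrite linear0 smul0l.
pose P (c : 'rV[F]_n) := (c \in C) && (c != 0).
have Pc0 : P c0 by rewrite /P Cc0.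
have [c /andP[Cc nz_c] c_min] := @arg_minnP _ c0 P
  (fun c => size (rVpoly c)) Pc0.
have nz_pc : lead_coef (rVpoly c) != 0.
  rewrite lead_coef_eq0; apply: contraNneq nz_c => pc0.
  by rewrite -[c]rVpolyK pc0 linear0.
pose c1 := (lead_coef (rVpoly c))^-1 *: c; set g := rVpoly c1.
have Cc1 : c1 \in C by apply: C_scale.
have mon_g : g \is monic.
  by rewrite /g linearZ monicE lead_coefZ mulVf.
have size_g : size g = size (rVpoly c).
  by rewrite /g linearZ size_scale ?invr_eq0.
(* The remainder of [f] by [g] stays in the code and is shorter than the minimal word, hence zero.
   Allowing [f] of any size covers [x^n - b], whose residue is 0. *)
have g_dvd f : vb b f \in C -> rdvd theta g f.
  move=> Cf; have [def_f lt_r] := sdivmodP theta f mon_g.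
  set q := (sdivmod _ _ _).1 in def_f; set r := (sdivmod _ _ _).2 in def_f lt_r.
  have le_rn : (size r <= n)%N.
    exact/(leq_trans (ltnW lt_r))/size_rVpoly.
  have Cr : poly_rV r \in C.
    rewrite -(vb_rVpoly b (poly_rV r)) poly_rV_K //.
    have -> : r = f - q ** g by rewrite [X in _ = X - _]def_f addrC addKr.
    by rewrite linearB C_sub // /g -rpolyE C_mul.
  have r0 : poly_rV r = 0 :> 'rV[F]_n.
    apply/eqP; apply: contraTT lt_r => nz_r.
    by rewrite -leqNgt size_g -(poly_rV_K le_rn) c_min // /P Cr.
  by exists q; rewrite {1}def_f -(poly_rV_K le_rn) r0 linear0 addr0.
have Dg : Dset b g.
  split=> //; apply: g_dvd.
  by rewrite -[xnb n b](smul1l theta) vb_smul_xnb.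
exists g => //; apply/setP=> d; apply/idP/idP => [|Cd].
  case/(im_circP _ Dg) => s def_d.
  by rewrite -(vb_rVpoly b d) def_d /g -rpolyE C_mul.
by apply/(im_circP _ Dg)/g_dvd; rewrite vb_rVpoly.
Qed.

(** * The anti-isomorphisms given by row spaces, duals and [delta] *)

Lemma im_circ_anti_iso b :
  anti_iso (Dset b) (constacyclic theta b) (rdvd theta) subset_rel
    (fun g => im (circ b g)).
Proof.
split=> [g|g h|C|g h].
- exact: im_circ_constacyclic.
- exact: im_circ_inj.
- exact: constacyclic_generator.
- exact: im_circ_subset.
Qed.

Lemma dual_dual_constacyclic b (C : {set 'rV[F]_n}) :
  constacyclic theta b C -> dual (dual C) = C.
Proof.
by case/constacyclic_generator => g Dg <-; rewrite im_circE // dual_dual_submx.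
Qed.

Lemma dual_constacyclic a (C : {set 'rV[F]_n}) :
  a != 0 -> constacyclic theta a C ->
  constacyclic theta a^-1 (dual C).
Proof.
move=> nz_a /constacyclic_generator[g Dg <-]; rewrite -im_delta //.
exact/im_circ_constacyclic/delta_Dset.
Qed.

Lemma dual_subset_constacyclic b (C D : {set 'rV[F]_n}) :
  constacyclic theta b C -> constacyclic theta b D ->
  C \subset D <-> dual D \subset dual C.
Proof.
move=> cC cD; split; first exact: dual_subset.
rewrite -{2}(dual_dual_constacyclic cC) -{2}(dual_dual_constacyclic cD).
exact: dual_subset.
Qed.

Lemma dual_anti_iso a : a != 0 ->
  anti_iso (constacyclic theta a) (constacyclic theta a^-1) subset_rel
    subset_rel (@dual F n).
Proof.
move=> nz_a; split=> [C|C D cC cD eq_dual|C cC|C D].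
- exact: dual_constacyclic.
- by rewrite -(dual_dual_constacyclic cC) eq_dual (dual_dual_constacyclic cD).
(* The dual is its own preimage candidate: [(a^-1)^-1 = a] places it among the codes for [a]. *)
- exists (dual C); last exact: dual_dual_constacyclic cC.
  by rewrite -[a]invrK; apply: dual_constacyclic; rewrite ?invr_eq0.
- exact: dual_subset_constacyclic.
Qed.

(** By [im_delta], [delta] is duality conjugated by the row-space maps, so injectivity, surjectivity
    and order reversal all transfer from there. *)
Lemma delta_anti_iso a : a != 0 ->
  anti_iso (Dset a) (Dset a^-1) (rdvd theta) (rdvd theta) (delta theta n a).
Proof.
move=> nz_a; have nz_Va : a^-1 != 0 by rewrite invr_eq0.
split=> [g|g h Dg Dh eq_d|g Dg|g h Dg Dh].
- exact: delta_Dset.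
- apply: (im_circ_inj Dg Dh).
  rewrite -(dual_dual_constacyclic (im_circ_constacyclic Dg)) -im_delta // eq_d.
  by rewrite im_delta // (dual_dual_constacyclic (im_circ_constacyclic Dh)).
- have cC := im_circ_constacyclic Dg.
  (* The preimage of [g] is the generator of the dual of the code of [g]. *)
  have := dual_constacyclic nz_Va cC; rewrite invrK.
  case/constacyclic_generator => h Dh eq_im; exists h => //.
  apply: (im_circ_inj (delta_Dset n_gt0 nz_a Dh) Dg).
  by rewrite (im_delta nz_a Dh) eq_im (dual_dual_constacyclic cC).
have [Dg' Dh'] := (delta_Dset n_gt0 nz_a Dg, delta_Dset n_gt0 nz_a Dh).
have [cg ch] := (im_circ_constacyclic Dg, im_circ_constacyclic Dh).
apply: iff_trans (im_circ_subset Dg Dh) _.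
apply: iff_trans (dual_subset_constacyclic ch cg) _.
rewrite -(im_delta nz_a Dg) -(im_delta nz_a Dh).
exact: iff_sym (im_circ_subset Dh' Dg').
Qed.
End ConstacyclicCodes.

Unset Implicit Arguments.

Theorem theorem6p3 (F : finFieldType) (theta : {rmorphism F -> F}) (n : nat)
  (a : F) :
  (0 < n)%N -> a != 0 ->
  [/\ anti_iso (Dset theta n a) (Dset theta n a^-1) (rdvd theta) (rdvd theta)
        (delta theta n a),
      anti_iso (Dset theta n a) (constacyclic theta a) (rdvd theta) subset_rel
        (fun g => im (circ theta n a g)),
      anti_iso (Dset theta n a^-1) (constacyclic theta a^-1) (rdvd theta)
        subset_rel (fun g => im (circ theta n a^-1 g)),
      anti_iso (constacyclic theta a) (constacyclic theta a^-1) subset_rel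
        subset_rel (@dual F n)
    & (forall g, Dset theta n a g ->
         [/\ im (circ theta n a^-1 (delta theta n a g))
              = dual (im (circ theta n a g)),
              dual (im (circ theta n a g))
              = im (circ theta n a^-1 (delta theta n a g))
            & im (circ theta n a^-1 (delta theta n a g))
              = im (circ theta n a^-1 (hhat theta n a g))])].
Proof.
move=> n_gt0 nz_a; split.
- exact: delta_anti_iso.
- exact: im_circ_anti_iso.
- exact: im_circ_anti_iso.
- exact: dual_anti_iso.
move=> g Dg; have eq_im := im_delta n_gt0 nz_a Dg; split=> //.
(* [delta] and [hhat] differ by a nonzero scalar, which leaves the row space unchanged. *)
exact: im_circ_scale (delta_scale_neq0 n_gt0 nz_a Dg).
Qed.
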